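(* Let $0<p<2$. Then the minimizers, over all Borel probability measures $\mu$ on $S^{d-1}$, of the probabilistic $p$-frame potential $$\mathrm{PFP}(\mu,p)=\int_{S^{d-1}}\int_{S^{d-1}}|\langle x,y\rangle|^p\,d\mu(x)\,d\mu(y)$$ are exactly those probability measures $\mu$ that satisfy both of the following: (i) there is an orthonormal basis $\{x_1,\dots,x_d\}$ of $\mathbb{R}^d$ such that $\{x_1,\dots,x_d\}\subset\operatorname{supp}(\mu)\subset\{\pm x_1,\dots,\pm x_d\}$; (ii) (for this basis) there is a function $f:S^{d-1}\to\mathbb{R}$ such that $\mu=f\,\nu_{\pm x_1,\dots,\pm x_d}$, i.e. $\mu$ has density $f$ with respect to $\nu_{\pm x_1,\dots,\pm x_d}$, and $f(x_i)+f(-x_i)=\frac1d$ for all $i=1,\dots,d$.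
   Context: $S^{d-1}$ is the unit sphere of $\mathbb{R}^d$ and $\operatorname{supp}(\mu)$ denotes the support of $\mu$. The measure $\nu_{\pm x_1,\dots,\pm x_d}$ is the counting measure of the set $\{\pm x_i: i=1,\dots,d\}$. *)

(* Defs.v *)
From HB Require Import structures.
From mathcomp Require Import all_boot all_order all_algebra.
From mathcomp Require Import all_classical all_reals all_analysis.
From mathcomp Require Import measurable_realfun.
Set Implicit Arguments.
Unset Strict Implicit.
Unset Printing Implicit Defensive.
Import Order.TTheory GRing.Theory Num.Theory.
Import numFieldNormedType.Exports.
Local Open Scope classical_set_scope.
Local Open Scope ring_scope.

Definition dot (R : realType) (d : nat) (x y : 'rV[R]_d) : R :=
  \sum_(i < d) x ord0 i * y ord0 i.

(* The library norm `|x| on 'rV[R]_d is the sup norm; it induces the usual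
   topology, but the unit sphere must be taken for the Euclidean norm. *)
Definition enorm (R : realType) (d : nat) (x : 'rV[R]_d) : R :=
  Num.sqrt (dot x x).

(* sphere R n is the unit sphere S^n of R^(n+1), so d = n.+1.  It is a subtype
   of 'rV[R]_n.+1; its topology is the subspace topology and its measurable
   sets are the Borel sets of that topology.  The dimension is a successor
   because the library's measurable types are nonempty, whereas S^(-1) is
   empty and carries no probability measure. *)
Definition sphere (R : realType) (n : nat) : Type :=
  [set x : 'rV[R]_n.+1 | enorm x = 1].

HB.instance Definition _ (R : realType) (n : nat) :=
  Topological.copy (sphere R n) (set_type [set x : 'rV[R]_n.+1 | enorm x = 1]).

Definition sval_sphere (R : realType) (n : nat) (x : sphere R n) :
  'rV[R]_n.+1 := set_val x.

Lemma enorm_sval (R : realType) (n : nat) (x : sphere R n) :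
  enorm (sval_sphere x) = 1.
Proof. exact: (set_mem (valP x)). Qed.

Lemma enorm_delta (R : realType) (n : nat) :
  enorm (delta_mx ord0 ord0 : 'rV[R]_n.+1) = 1.
Proof.
rewrite /enorm /dot big_ord_recl big1 ?addr0; last first.
  by move=> i _; rewrite !mxE eqxx mul0r.
by rewrite !mxE !eqxx mulr1 sqrtr1.
Qed.

HB.instance Definition _ (R : realType) (n : nat) :=
  isPointed.Build (sphere R n) (SigSub (mem_set (@enorm_delta R n))).

HB.instance Definition _ (R : realType) (n : nat) :=
  Measurable.copy (sphere R n) (g_sigma_algebraType (@open (sphere R n))).

Lemma enorm_opp (R : realType) (n : nat) (x : sphere R n) :
  enorm (- sval_sphere x) = 1.
Proof.
rewrite -(enorm_sval x) /enorm /dot; congr Num.sqrt.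
by apply: eq_bigr => i _; rewrite !mxE mulrNN.
Qed.

Definition antipode (R : realType) (n : nat) (x : sphere R n) : sphere R n :=
  SigSub (mem_set (enorm_opp x)).

Lemma sval_antipode (R : realType) (n : nat) (x : sphere R n) :
  sval_sphere (antipode x) = - sval_sphere x.
Proof. by []. Qed.

Definition sdot (R : realType) (n : nat) (x y : sphere R n) : R :=
  dot (sval_sphere x) (sval_sphere y).

Definition PFP (R : realType) (n : nat)
    (mu : probability (sphere R n) R) (p : R) : \bar R :=
  (\int[mu]_y \int[mu]_x (`|sdot x y| `^ p)%:E)%E.

Definition PFP_minimizer (R : realType) (n : nat) (p : R)
    (mu : probability (sphere R n) R) : Prop :=
  forall nu : probability (sphere R n) R, (PFP mu p <= PFP nu p)%E.

Definition supp (R : realType) (n : nat)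
    (mu : probability (sphere R n) R) : set (sphere R n) :=
  [set x | forall U : set (sphere R n), open_nbhs x U -> (0 < mu U)%E].

Definition orthonormal_basis (R : realType) (n : nat)
    (x : 'I_n.+1 -> sphere R n) : Prop :=
  basis_of fullv (codom (fun i => sval_sphere (x i))) /\
  (forall i j, sdot (x i) (x j) = (i == j)%:R).

Definition pm_set (R : realType) (n : nat) (x : 'I_n.+1 -> sphere R n) :
  set (sphere R n) := range x `|` range (fun i => antipode (x i)).

Lemma sphere_hausdorff (R : realType) (n : nat) :
  hausdorff_space (sphere R n).
Proof.
have := @norm_hausdorff R ('rV[R]_n.+1 : normedModType R).
rewrite !open_hausdorff => H x y xy.
have : set_val x != set_val y :> 'rV[R]_n.+1.
  by apply: contra_neq xy => /val_inj.
move=> /H[[A B] /= [xA yB] [oA oB AB0]].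
exists (set_val @^-1` A, set_val @^-1` B); first by [].
split; [by exists A|by exists B|].
by rewrite -preimage_setI (eqP AB0) preimage_set0.
Qed.

Lemma measurable_pm_set (R : realType) (n : nat) (x : 'I_n.+1 -> sphere R n) :
  measurable (pm_set x).
Proof.
have cpm : closed (pm_set x).
  have /accessible_finite_set_closed :=
    hausdorff_accessible (@sphere_hausdorff R n).
  apply.
  by rewrite finite_setU; split; exact/finite_image/finite_finset.
rewrite -(setCK (pm_set x)); apply: measurableC.
by apply: sub_sigma_algebra; exact: closed_openC.
Qed.

(* The counting measure of the set pm_set x, as a measure on the sphere:
   A |-> #|A `&` pm_set x|. *)
Definition nu_pm (R : realType) (n : nat) (x : 'I_n.+1 -> sphere R n) :
    {measure set (sphere R n) -> \bar R} :=
  mrestr (@counting (sphere R n) R) (measurable_pm_set x).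

Definition has_density (d : measure_display) (T : measurableType d)
    (R : realType) (mu nu : {measure set T -> \bar R}) (f : T -> R) : Prop :=
  measurable_fun setT f /\
  forall A : set T, measurable A -> mu A = (\int[nu]_(x in A) (f x)%:E)%E.

(* Main.v *)
Require Import Defs.
From HB Require Import structures.
From mathcomp Require Import all_boot all_order all_algebra.
From mathcomp Require Import all_classical all_reals all_analysis.
From mathcomp Require Import measurable_realfun.
From mathcomp Require Import ring lra.
From mathcomp Require finmap.
Set Implicit Arguments.
Unset Strict Implicit.
Unset Printing Implicit Defensive.
Import Order.TTheory GRing.Theory Num.Theory.
Import numFieldNormedType.Exports.
Local Open Scope classical_set_scope.
Local Open Scope ring_scope.

(** Write d for the dimension n.+1 of the ambient space, and let G be the matrix
    of second moments G_kl = \int x_k x_l dmu, whose trace is 1 because mu lives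
    on the sphere.

    Lower bound.  On [0, 1] one has t^2 <= t^p since p < 2, so
    PFP(mu, p) >= \int\int <x, y>^2 = \sum_kl G_kl^2
                = 1/d + \sum_kl (G_kl - delta_kl / d)^2 >= 1/d
    ([PFP_ge], [sum_moment2_sqr], [PFP_lower_bound]).  A measure that gives mass
    1/d to each pair {x_i, -x_i} of an orthonormal basis attains 1/d, because
    for x and y in the frame |<x, y>|^p is the indicator of y = x or y = -x
    ([PFP_balanced]).  Such measures exist, so 1/d is the minimum.

    Equality case.  If PFP(mu, p) <= 1/d, then both inequalities above are
    equalities.  The second one says G = I/d, that is,
    \int <x, y>^2 dmu(x) = 1/d for every unit vector y
    ([Rintegral_sdot_sqr_isotropic]).  The first one, as t^2 < t^p strictly
    inside (0, 1), says that two points of the support are orthogonal, equal or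
    antipodal ([supp_sdot01]).  Given k < d orthonormal points x_i of the
    support, \sum_i <x_i, y>^2 has integral k/d < 1, so it is not everywhere at
    least 1 on the support, and a point of the support where it is not is
    orthogonal to all the x_i ([supp_extend]).  After d steps the support
    contains an orthonormal basis; any further point of the support is not
    orthogonal to all of it, hence is some x_i or -x_i.  Finally the mass of
    {x_i, -x_i} is \int <x_i, y>^2 dmu(y) = 1/d ([pair_set_mass]), and a measure
    carried by finitely many points has its atoms as density with respect to
    the counting measure of these points ([atomic_density]). *)

(** * Topology and measurability on the sphere *)

Section topology.
Context {R : realType} {n : nat}.
Local Notation S := (sphere R n).
Local Notation coord := (fun (k : 'I_n.+1) (x : S) => sval_sphere x ord0 k).

Lemma open_sphere_measurable (U : set S) : open U -> measurable U.
Proof. by move=> oU; apply: sub_sigma_algebra. Qed.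

Lemma closed_sphere_measurable (C : set S) : closed C -> measurable C.
Proof.
move=> cC; rewrite -(setCK C); apply: measurableC.
by apply: open_sphere_measurable; exact: closed_openC.
Qed.

Lemma measurable_sphere1 (x : S) : measurable [set x].
Proof.
apply: closed_sphere_measurable; apply: accessible_closed_set1.
exact/hausdorff_accessible/sphere_hausdorff.
Qed.

Lemma continuous_sphere_measurable (f : S -> R) :
  continuous f -> measurable_fun setT f.
Proof.
move=> /continuousP cf; apply: (measurability _ (RGenOpens.measurableE R)).
move=> _ [_ [a [b ->] <-]]; rewrite setTI; apply: open_sphere_measurable.
exact/cf/interval_open.
Qed.

Lemma continuous_sval : continuous (@sval_sphere R n).
Proof. exact: initial_continuous. Qed.

Lemma continuous_coord k : continuous (coord k).
Proof.
move=> x; apply: (@continuous_comp S _ _ (@sval_sphere R n) (fun v => v ord0 k)).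
  exact: continuous_sval.
exact: coord_continuous.
Qed.

Lemma measurable_coord k : measurable_fun setT (coord k).
Proof. exact: (continuous_sphere_measurable (@continuous_coord k)). Qed.

(** Joint measurability for the product of the Borel sigma-algebras: this is what
    makes the inner integral of the potential a measurable function of y. *)
Lemma measurable_sdot2 :
  measurable_fun setT (fun z : S * S => sdot z.1 z.2).
Proof.
apply: measurable_sum => k; apply: measurable_funM.
- exact: (measurableT_comp (measurable_coord k) measurable_fst).
- exact: (measurableT_comp (measurable_coord k) measurable_snd).
Qed.

Lemma continuous_sdot2 : continuous (fun z : S * S => sdot z.1 z.2).
Proof.
apply: (@continuous_big R 'I_n.+1 +%R 0 xpredT _ (S * S)%type _
    (fun k z => sval_sphere z.1 ord0 k * sval_sphere z.2 ord0 k)) => [|k _ z].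
  exact: add_continuous.
apply: (@cvgM R (S * S)%type).
- apply: (@continuous_comp (S * S)%type S R fst (coord k) z).
    exact: cvg_fst.
  exact: continuous_coord.
- apply: (@continuous_comp (S * S)%type S R snd (coord k) z).
    exact: cvg_snd.
  exact: continuous_coord.
Qed.

End topology.

(** * Inner products of unit vectors *)

Section dot.
Context {R : realType} {m : nat}.
Implicit Types u v w : 'rV[R]_m.

Lemma dotC u v : dot u v = dot v u.
Proof. by apply: eq_bigr => i _; rewrite mulrC. Qed.

Lemma dotDl u v w : dot (u + v) w = dot u w + dot v w.
Proof. by rewrite /dot -big_split; apply: eq_bigr => i _; rewrite mxE mulrDl. Qed.

Lemma dotZl a u v : dot (a *: u) v = a * dot u v.
Proof. by rewrite /dot mulr_sumr; apply: eq_bigr => i _; rewrite mxE mulrA. Qed.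

Lemma dotNl u v : dot (- u) v = - dot u v.
Proof. by rewrite -scaleN1r dotZl mulN1r. Qed.

Lemma dotDr u v w : dot w (u + v) = dot w u + dot w v.
Proof. by rewrite dotC dotDl !(dotC w). Qed.

Lemma dotNr u v : dot v (- u) = - dot v u.
Proof. by rewrite dotC dotNl dotC. Qed.

Lemma dot_ge0 u : 0 <= dot u u.
Proof. by apply: sumr_ge0 => i _; rewrite -expr2 sqr_ge0. Qed.

Lemma dot_eq0 u : dot u u = 0 -> u = 0.
Proof.
move=> /eqP; rewrite psumr_eq0; last by move=> i _; rewrite -expr2 sqr_ge0.
move=> /allP h; apply/rowP => i; rewrite mxE; apply/eqP.
by have := h i (mem_index_enum _); rewrite /= mulf_eq0 orbb.
Qed.

Lemma dot_expand u v (s : R) :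
  dot (u - s *: v) (u - s *: v) = dot u u - 2 * s * dot v u + s ^+ 2 * dot v v.
Proof.
rewrite dotDl !dotDr !(dotNl, dotNr) !(dotC _ (s *: v)) !dotZl.
by rewrite (dotC v (s *: v)) dotZl; ring.
Qed.

End dot.

Section sphere_algebra.
Context {R : realType} {n : nat}.
Implicit Types x y z : sphere R n.

Lemma sdotC x y : sdot x y = sdot y x.
Proof. exact: dotC. Qed.

Lemma sdotxx x : sdot x x = 1.
Proof.
have := enorm_sval x; rewrite /enorm => /(congr1 (fun t => t ^+ 2)).
by rewrite sqr_sqrtr ?dot_ge0// expr1n.
Qed.

(** Cauchy-Schwarz: the projection of y off the line of x has squared norm
    1 - <x, y>^2. *)
Lemma sdot_sqr_le1 x y : sdot x y ^+ 2 <= 1.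
Proof.
have := dot_ge0 (sval_sphere y - sdot x y *: sval_sphere x).
rewrite dot_expand.
rewrite -/(sdot x y) -/(sdot x x) -/(sdot y y) !sdotxx; nra.
Qed.

Lemma normr_sdot_le1 x y : `|sdot x y| <= 1.
Proof. by have := sdot_sqr_le1 x y; rewrite -real_normK ?num_real// expr_le1. Qed.

Lemma sdot_antipodel x y : sdot (antipode x) y = - sdot x y.
Proof. exact: dotNl. Qed.

Lemma sdot_antipoder x y : sdot x (antipode y) = - sdot x y.
Proof. exact: dotNr. Qed.

(** The same projection vanishes in the equality case of Cauchy-Schwarz. *)
Lemma normr_sdot_eq1 x y : `|sdot x y| = 1 -> y = x \/ y = antipode x.
Proof.
move=> xy; have : (sdot x y) ^+ 2 = 1 by rewrite -real_normK ?num_real// xy expr1n.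
move=> xy2; have : sval_sphere y - sdot x y *: sval_sphere x = 0.
  apply: dot_eq0; rewrite dot_expand -/(sdot x y) -/(sdot x x) -/(sdot y y).
  by rewrite !sdotxx -mulrA -expr2 xy2; ring.
move=> /eqP; rewrite subr_eq0 => /eqP yx.
move: xy2 => /eqP; rewrite sqrf_eq1 => /orP[]/eqP e; [left|right];
  apply: val_inj; move: yx; rewrite e ?scale1r ?scaleN1r; exact.
Qed.

Lemma antipode_neq x : x <> antipode x.
Proof.
move=> /(congr1 (sdot x)); rewrite sdot_antipoder sdotxx; lra.
Qed.

(** The entries of the matrix x (x) x, with both indices packed in a pair so that
    quadratic forms are sums over one finite type. *)
Definition tensor2 (k : 'I_n.+1 * 'I_n.+1) x : R :=
  sval_sphere x ord0 k.1 * sval_sphere x ord0 k.2.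

(** <x, y>^2 is the Frobenius product of x (x) x and y (x) y; the variables
    separate, and its double integral becomes a sum of squares of moments. *)
Lemma sdot_sqr_tensor2 x y :
  sdot x y ^+ 2 = \sum_k tensor2 k x * tensor2 k y.
Proof.
rewrite expr2 /sdot /dot big_distrlr /= pair_bigA/=; apply: eq_bigr => k _.
by rewrite mulrACA.
Qed.

Lemma coord_le1 x k : `|sval_sphere x ord0 k| <= 1.
Proof.
suff : sval_sphere x ord0 k ^+ 2 <= 1.
  by rewrite -real_normK ?num_real// expr_le1.
rewrite -(sdotxx x) /sdot /dot (bigD1 k)//= -expr2 lerDl.
by apply: sumr_ge0 => i _; rewrite -expr2 sqr_ge0.
Qed.

Lemma tensor2_le1 k x : `|tensor2 k x| <= 1.
Proof. by rewrite normrM mulr_ile1// coord_le1. Qed.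

Lemma measurable_tensor2 k : measurable_fun setT (tensor2 k).
Proof. by apply: measurable_funM; exact: measurable_coord. Qed.

End sphere_algebra.

(** * Integrals of bounded functions *)

Section probability_integral.
Context d (T : measurableType d) (R : realType) (mu : probability T R).

Lemma bounded_integrable (f : T -> R) (M : R) :
  measurable_fun setT f -> (forall x, `|f x| <= M) ->
  mu.-integrable setT (EFin \o f).
Proof.
move=> mf fM; apply: measurable_bounded_integrable => //.
  by rewrite [X in (X < _)%E]probability_setT ltry.
exists M; split; first exact: num_real.
by move=> N MN x _ /=; rewrite (le_trans (fM x))// ltW.
Qed.

Lemma EFin_Rintegral (f : T -> R) : mu.-integrable setT (EFin \o f) ->
  (\int[mu]_x (f x)%:E = (\int[mu]_x f x)%R%:E)%E.
Proof. by move=> intf; rewrite fineK//; exact: integrable_fin_num. Qed.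

Lemma integrable_scale (a : R) (f : T -> R) : mu.-integrable setT (EFin \o f) ->
  mu.-integrable setT (fun x => (a * f x)%:E).
Proof. by move=> intf; exact: (integrableZl measurableT a intf). Qed.

Lemma integrable_add (f g : T -> R) : mu.-integrable setT (EFin \o f) ->
  mu.-integrable setT (EFin \o g) ->
  mu.-integrable setT (EFin \o (fun x => f x + g x)).
Proof. by move=> intf intg; exact: (integrableD measurableT intf intg). Qed.

Lemma integrable_lin (I : finType) (a : I -> R) (f : I -> T -> R) :
  (forall i, mu.-integrable setT (EFin \o f i)) ->
  mu.-integrable setT (EFin \o (fun x => \sum_i a i * f i x)).
Proof.
move=> intf; rewrite (_ : _ \o _ = fun x => (\sum_i (a i * f i x)%:E)%E).
  apply: integrable_sum => // i _.
  exact: integrable_scale.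
by apply/funext => x /=; rewrite sumEFin.
Qed.

Lemma Rintegral_lin (I : finType) (a : I -> R) (f : I -> T -> R) :
  (forall i, mu.-integrable setT (EFin \o f i)) ->
  \int[mu]_x (\sum_i a i * f i x) = \sum_i a i * \int[mu]_x f i x.
Proof.
move=> intf; apply: EFin_inj; rewrite -EFin_Rintegral; last exact: integrable_lin.
under eq_integral do rewrite -sumEFin.
rewrite integral_sum//; last first.
  by move=> i; exact: integrable_scale.
rewrite -sumEFin; apply: eq_bigr => i _.
rewrite -RintegralZl// -EFin_Rintegral//; exact: integrable_scale.
Qed.

Lemma integrable_indicr (U : set T) (a : R) : measurable U ->
  mu.-integrable setT (EFin \o (fun x => a * \1_U x)).
Proof.
move=> mU; apply: (@bounded_integrable _ `|a|).
  exact: measurable_funM.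
move=> x; rewrite normrM ler_piMr// indicE.
by case: (_ \in _); rewrite ?normr1 ?normr0.
Qed.

Lemma Rintegral_indicr (U : set T) (a : R) : measurable U ->
  \int[mu]_x (a * \1_U x) = a * fine (mu U).
Proof.
move=> mU; rewrite RintegralZl//; last first.
  by have := integrable_indicr 1 mU; under [X in _ \o X]eq_fun do rewrite mul1r.
by rewrite /Rintegral integral_indic// setIT.
Qed.

End probability_integral.

(** * Second moments and the lower bound of the energy *)

Section moments.
Context {R : realType} {n : nat} (mu : probability (sphere R n) R).
Local Notation S := (sphere R n).

Lemma integrable_tensor2 k : mu.-integrable setT (EFin \o (@tensor2 R n k)).
Proof.
apply: (@bounded_integrable _ _ _ _ _ 1); first exact: measurable_tensor2.
exact: tensor2_le1.
Qed.

Definition moment2 k : R := \int[mu]_x tensor2 k x.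

Lemma Rintegral_sdot_sqr y :
  \int[mu]_x (sdot x y ^+ 2) = \sum_k moment2 k * tensor2 k y.
Proof.
under eq_Rintegral do rewrite sdotC sdot_sqr_tensor2.
rewrite Rintegral_lin//; last by move=> k; exact: integrable_tensor2.
by apply: eq_bigr => k _; rewrite mulrC.
Qed.

Lemma measurable_sdot y : measurable_fun setT (fun x : S => sdot x y).
Proof.
apply: measurable_sum => k; apply: measurable_funM => //.
exact: measurable_coord.
Qed.

Lemma integrable_sdot_sqr y :
  mu.-integrable setT (EFin \o (fun x => sdot x y ^+ 2)).
Proof.
apply: (@bounded_integrable _ _ _ _ _ 1).
  by apply: measurable_funX; exact: measurable_sdot.
by move=> x; rewrite ger0_norm ?sqr_ge0// sdot_sqr_le1.
Qed.

Lemma measurable_PFP_kernel (p : R) :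
  measurable_fun setT (fun z : S * S => (`|sdot z.1 z.2| `^ p)%:E).
Proof.
apply/measurable_EFinP; apply: (measurableT_comp (measurable_powR p)).
apply: measurableT_comp => //; exact: measurable_sdot2.
Qed.

Lemma measurable_PFP_inner (p : R) :
  measurable_fun setT (fun y => \int[mu]_x (`|sdot x y| `^ p)%:E)%E.
Proof.
have := @measurable_fun_fubini_tonelli_G _ _ S S R mu _ (@measurable_PFP_kernel p).
by apply => z; rewrite lee_fin powR_ge0.
Qed.

(** The double integral of <x, y>^2 is the squared Frobenius norm of the second
    moments.  The extra rectangle U x V is where the strict inequality
    <x, y>^2 < |<x, y>|^p will be quantified: it turns strictness near one point
    of supp mu x supp mu into a strict gain of energy, without any reasoning
    almost everywhere on the product. *)
Lemma PFP_ge (p c : R) (U V : set S) : 0 <= c -> measurable U -> measurable V ->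
  (forall x y, sdot x y ^+ 2 + c * \1_V y * \1_U x <= `|sdot x y| `^ p) ->
  ((\sum_k moment2 k ^+ 2 + c * fine (mu U) * fine (mu V))%:E <= PFP mu p)%E.
Proof.
move=> c0 mU mV le_kernel.
(* h y is the inner integral of the lower bound of the kernel *)
pose h y := \sum_k moment2 k * tensor2 k y + c * fine (mu U) * \1_V y.
have hE y : h y = \int[mu]_x (sdot x y ^+ 2 + c * \1_V y * \1_U x).
  rewrite RintegralD//.
  - by rewrite Rintegral_sdot_sqr Rintegral_indicr// /h mulrAC.
  - exact: integrable_sdot_sqr.
  - exact: integrable_indicr.
have h0 y : 0 <= h y.
  rewrite hE; apply: Rintegral_ge0 => x _.
  by rewrite addr_ge0 ?sqr_ge0// !mulr_ge0// indicE ler0n.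
have inth1 : mu.-integrable setT (EFin \o (fun y => \sum_k moment2 k * tensor2 k y)).
  by apply: integrable_lin => k; exact: integrable_tensor2.
have inth : mu.-integrable setT (EFin \o h).
  by apply: integrable_add => //; exact: integrable_indicr.
have -> : \sum_k moment2 k ^+ 2 + c * fine (mu U) * fine (mu V) = \int[mu]_y h y.
  rewrite RintegralD//; last exact: integrable_indicr.
  rewrite Rintegral_indicr// Rintegral_lin// => k.
  exact: integrable_tensor2.
rewrite -EFin_Rintegral//; apply: ge0_le_integral => //.
- by move=> y _; rewrite lee_fin.
- exact: measurable_int inth.
- exact: measurable_PFP_inner.
- move=> y _; rewrite hE -EFin_Rintegral; last first.
    by apply: integrable_add; [exact: integrable_sdot_sqr|exact: integrable_indicr].
  apply: ge0_le_integral => //.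
  + by move=> x _; rewrite lee_fin addr_ge0 ?sqr_ge0// !mulr_ge0// indicE ler0n.
  + apply/measurable_EFinP/measurable_funD.
      by apply: measurable_funX; exact: measurable_sdot.
    by apply: measurable_funM => //; exact: measurable_indic.
  + apply/measurable_EFinP/(measurableT_comp (measurable_powR p)).
    by apply: measurableT_comp => //; exact: measurable_sdot.
  + by move=> x _; rewrite lee_fin.
Qed.

(** Integrate |x|^2 = 1. *)
Lemma trace_moment2 : \sum_k moment2 (k, k) = 1.
Proof.
transitivity (\int[mu]_x \sum_k 1 * tensor2 (k, k) x).
  rewrite Rintegral_lin//; last by move=> k; exact: integrable_tensor2.
  by under [RHS]eq_bigr do rewrite mul1r.
under eq_Rintegral => x _.
  have -> : \sum_k 1 * tensor2 (k, k) x = 1 * \1_setT x.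
    under eq_bigr do rewrite mul1r.
    by rewrite indicT mul1r -(sdotxx x).
  over.
by rewrite Rintegral_indicr// mul1r [X in fine X]probability_setT.
Qed.

Local Notation d := (n.+1%:R : R).

(** Complete the square around the isotropic matrix I/d, using that the trace
    is 1; the remainder measures the distance to isotropy. *)
Lemma sum_moment2_sqr : \sum_k moment2 k ^+ 2 =
  d^-1 + \sum_k (moment2 k - d^-1 * (k.1 == k.2)%:R) ^+ 2.
Proof.
have d0 : d != 0 by rewrite pnatr_eq0.
have diag (F : 'I_n.+1 * 'I_n.+1 -> R) :
    \sum_k F k * (k.1 == k.2)%:R = \sum_k F (k, k).
  rewrite (eq_bigr (fun k => F (k.1, k.2) * (k.1 == k.2)%:R)); last by case.
  rewrite -(pair_bigA _ (fun i j => F (i, j) * (i == j)%:R))/=.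
  apply: eq_bigr => i _; rewrite (bigD1 i)//= eqxx mulr1 big1 ?addr0// => j ji.
  by rewrite eq_sym (negbTE ji) mulr0.
rewrite (eq_bigr (fun k => (moment2 k - d^-1 * (k.1 == k.2)%:R) ^+ 2 +
   (2 * d^-1 * moment2 k - d^-1 ^+ 2) * (k.1 == k.2)%:R)); last first.
  by move=> k _; case: (_ == _); rewrite ?mulr1 ?mulr0; ring.
rewrite big_split/= diag addrC; congr (_ + _).
rewrite sumrB -mulr_sumr trace_moment2 sumr_const card_ord -mulr_natr.
by field.
Qed.

Lemma moment2_isotropic : \sum_k moment2 k ^+ 2 <= d^-1 ->
  forall k, moment2 k = d^-1 * (k.1 == k.2)%:R.
Proof.
rewrite sum_moment2_sqr gerDl => le0 k.
have /eqP : \sum_k (moment2 k - d^-1 * (k.1 == k.2)%:R) ^+ 2 = 0.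
  by apply/eqP; rewrite eq_le le0 sumr_ge0// => i _; rewrite sqr_ge0.
rewrite psumr_eq0; last by move=> i _; rewrite sqr_ge0.
by move=> /allP/(_ k (mem_index_enum _)); rewrite sqrf_eq0 subr_eq0 => /eqP.
Qed.

End moments.

(** * The support has full measure *)

Section support.
Context {R : realType} {n : nat} (mu : probability (sphere R n) R).
Local Notation S := (sphere R n).

Lemma not_supp (y : S) : ~ supp mu y ->
  exists2 U : set S, open_nbhs y U & mu U = 0.
Proof.
move=> /existsNP[U] /not_implyP[yU /negP]; rewrite -leNgt => U0.
by exists U => //; apply/eqP; rewrite eq_le U0 measure_ge0.
Qed.

Lemma open_setC_supp : open (~` supp mu).
Proof.
rewrite openE => y /not_supp[U [oU Uy] U0]; exists U; split => // z Uz.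
by move=> /(_ U); rewrite U0 ltxx => /(_ (conj oU Uz)).
Qed.

Lemma rat_rV_ball (y : 'rV[R]_n.+1) (e : R) : 0 < e ->
  exists q : 'rV[rat]_n.+1, ball (map_mx ratr q : 'rV[R]_n.+1) e y.
Proof.
move=> e0.
have H (k : 'I_n.+1) : exists r : rat, ball (ratr r : R) e (y ord0 k).
  have /rat_in_itvoo[r] : y ord0 k - e < y ord0 k + e by lra.
  rewrite in_itv/= => /andP[r1 r2]; exists r.
  by rewrite /ball/= ltr_norml; apply/andP; split; lra.
exists (\row_k projT1 (cid (H k))); split=> // i j.
by rewrite !mxE (ord1 i); case: cid.
Qed.

(** The space is second countable: the complement of the support is covered by
    the null balls among those with rational centre and radius 1/(m+1), and a
    countable union of null sets is null. *)
Lemma measure_setC_supp : mu (~` supp mu) = 0.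
Proof.
pose B (c : 'rV[rat]_n.+1 * nat) : set S :=
  @sval_sphere R n @^-1` (ball (map_mx ratr c.1 : 'rV[R]_n.+1) c.2.+1%:R^-1).
have oB c : open (B c).
  apply: open_comp; first by move=> x _; exact: continuous_sval.
  exact: ball_open.
(* F enumerates the null rational balls, completed by empty sets *)
pose F k : set S := if unpickle k is Some c then
  (if mu (B c) == 0 then B c else set0) else set0.
have Fneg k : mu.-negligible (F k).
  rewrite /F; case: unpickle => [c|]; last exact: negligible_set0.
  case: eqP => [B0|_]; last exact: negligible_set0.
  by apply/negligibleP => //; exact: open_sphere_measurable.
have [N [mN N0 subN]] := negligible_bigcup Fneg.
apply: (subset_measure0 _ mN _ N0).
  exact: (open_sphere_measurable open_setC_supp).
apply: subset_trans subN => y /not_supp[U [oU Uy] U0].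
have [W oW WU] : exists2 W, open W & @sval_sphere R n @^-1` W = U.
  by case: oU => W; exists W.
have /nbhs_ballP[e /= e0 eW] : nbhs (sval_sphere y) W.
  by apply: open_nbhs_nbhs; split => //; move: Uy; rewrite -WU.
have [m me] : exists m : nat, m.+1%:R^-1 < e / 2.
  have /= := near_infty_natSinv_lt (PosNum (divr_gt0 e0 (ltr0n R 2))).
  by case => m _ /(_ m (leqnn m)) /= ?; exists m.
have m0 : 0 < m.+1%:R^-1 :> R by rewrite invr_gt0.
have [q yq] := rat_rV_ball (sval_sphere y) m0.
exists (pickle (q, m)) => //; rewrite /F pickleK/=.
suff -> : mu (B (q, m)) = 0 by rewrite eqxx.
apply: (subset_measure0 _ _ _ U0).
- exact: open_sphere_measurable.
- exact: open_sphere_measurable.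
- rewrite -WU => z /= qz; apply: eW.
  apply: (@le_ball _ _ _ (m.+1%:R^-1 + m.+1%:R^-1)).
    by rewrite (splitr e) lerD// ltW.
  apply: ball_triangle qz; exact: ball_sym.
Qed.

End support.

(** * Comparison of the kernels t^p and t^2 *)

Section kernel.
Context {R : realType}.
Implicit Types (p t a b : R).

Lemma sqr_powR_split p t : 0 <= t -> t ^+ 2 = t `^ p * t `^ (2 - p).
Proof. by move=> t0; rewrite -powRD subrKC ?powR_mulrn// pnatr_eq0. Qed.

Lemma sqr_le_powR p t : p < 2 -> 0 <= t <= 1 -> t ^+ 2 <= t `^ p.
Proof.
move=> p2 /andP[t0 t1]; rewrite (@sqr_powR_split p)//.
rewrite ler_piMr ?powR_ge0//.
have := @ge0_ler_powR _ (2 - p) _ t 1; rewrite powR1; apply; rewrite ?nnegrE; lra.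
Qed.

(** From t^p - t^2 = t^p (1 - t^(2 - p)), a product of an increasing and a
    decreasing factor: a gap that is uniform on [a, b]. *)
Lemma sqr_powR_gap p a b t : 0 < p -> p < 2 -> 0 < a -> a <= t <= b -> b < 1 ->
  t ^+ 2 + a `^ p * (1 - b `^ (2 - p)) <= t `^ p.
Proof.
move=> p0 p2 a0 /andP[la lb] b1; have t0 : 0 <= t by lra.
rewrite (@sqr_powR_split p)// -lerBrDl -{1}(mulr1 (t `^ p)) -mulrBr.
have b2 : b `^ (2 - p) <= 1.
  have := @ge0_ler_powR _ (2 - p) _ b 1; rewrite powR1; apply; rewrite ?nnegrE; lra.
apply: ler_pM; rewrite ?powR_ge0//.
- by rewrite subr_ge0.
- apply: ge0_ler_powR; rewrite ?nnegrE; lra.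
- rewrite lerB//; apply: ge0_ler_powR; rewrite ?nnegrE; lra.
Qed.

Lemma powR_gap_gt0 p a b : p < 2 -> 0 < a -> 0 <= b < 1 ->
  0 < a `^ p * (1 - b `^ (2 - p)).
Proof.
move=> p2 a0 /andP[b0 b1]; rewrite mulr_gt0 ?powR_gt0// subr_gt0.
have := @gt0_ltr_powR _ (2 - p) _ b 1; rewrite powR1; apply; rewrite ?nnegrE; lra.
Qed.

End kernel.

Section energy.
Context {R : realType} {n : nat} (mu : probability (sphere R n) R).
Context (p : R) (p0 : 0 < p) (p2 : p < 2).
Local Notation S := (sphere R n).
Local Notation d := (n.+1%:R : R).

Lemma sdot_sqr_le_kernel (x y : S) : sdot x y ^+ 2 <= `|sdot x y| `^ p.
Proof.
by rewrite -real_normK ?num_real// sqr_le_powR// normr_ge0 normr_sdot_le1.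
Qed.

Lemma sum_moment2_sqr_le_PFP : ((\sum_k moment2 mu k ^+ 2)%:E <= PFP mu p)%E.
Proof.
have := @PFP_ge R n mu p 0 set0 set0 (lexx 0) measurable0 measurable0.
rewrite !mul0r addr0; apply => x y.
by rewrite !mul0r addr0; exact: sdot_sqr_le_kernel.
Qed.

Lemma PFP_lower_bound : ((d^-1)%:E <= PFP mu p)%E.
Proof.
apply: le_trans sum_moment2_sqr_le_PFP; rewrite lee_fin sum_moment2_sqr lerDl.
by apply: sumr_ge0 => k _; exact: sqr_ge0.
Qed.

(** If t = |<x, y>| is neither 0 nor 1 for some x, y in the support, then
    |<u, v>|^p exceeds <u, v>^2 by a constant for u near x and v near y, and
    these neighbourhoods have positive mass, so the energy exceeds 1/d. *)
Lemma supp_sdot01 (x y : S) : (PFP mu p <= (d^-1)%:E)%E ->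
  supp mu x -> supp mu y -> sdot x y = 0 \/ `|sdot x y| = 1.
Proof.
move=> PFPle sx sy; apply: contrapT => /not_orP[xy0 xy1].
set t := `|sdot x y|.
have t0 : 0 < t by rewrite normr_gt0; exact/eqP.
have t1 : t < 1 by rewrite lt_neqAle normr_sdot_le1 andbT; exact/eqP.
(* the window ]a, b[ around t stays away from both 0 and 1 *)
pose a := t / 2; pose b := (1 + t) / 2.
have ab : a < t < b by rewrite /a /b; apply/andP; split; lra.
have : nbhs (x, y) [set z : S * S | `|sdot z.1 z.2| \in `]a, b[].
  have cnt : (fun z : S * S => `|sdot z.1 z.2|) @ nbhs (x, y) --> t.
    by apply: cvg_norm; exact: (@continuous_sdot2 R n (x, y)).
  have abt : nbhs t `]a, b[%classic.
    by apply: open_nbhs_nbhs; split; [exact: interval_open|rewrite /= in_itv].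
  exact: (cnt _ abt).
move=> [[A B] /= [+ +] AB].
rewrite !nbhsE => -[U oU UA] [V oV VB].
pose c := a `^ p * (1 - b `^ (2 - p)).
have c0 : 0 < c.
  apply: powR_gap_gt0 => //; rewrite /a /b ?divr_gt0//.
  by apply/andP; split; lra.
have mU : measurable U by apply: open_sphere_measurable; case: oU.
have mV : measurable V by apply: open_sphere_measurable; case: oV.
have muU : 0 < fine (mu U).
  by rewrite fine_gt0// (sx U oU)/= (le_lt_trans (probability_le1 _ _)) ?ltry.
have muV : 0 < fine (mu V).
  by rewrite fine_gt0// (sy V oV)/= (le_lt_trans (probability_le1 _ _)) ?ltry.
have kernel (u v : S) : sdot u v ^+ 2 + c * \1_V v * \1_U u <= `|sdot u v| `^ p.
  rewrite !indicE; have [uU|] := boolP (u \in U); last first.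
    by rewrite mulr0 addr0 sdot_sqr_le_kernel.
  have [vV|] := boolP (v \in V); last first.
    by rewrite mulr0 mul0r addr0 sdot_sqr_le_kernel.
  rewrite !mulr1 -real_normK ?num_real//; apply: sqr_powR_gap => //.
  - by rewrite divr_gt0.
  - have /AB /= : (A `*` B) (u, v) by split; [exact/UA/set_mem|exact/VB/set_mem].
    by rewrite in_itv/= => /andP[/ltW -> /ltW ->].
  - rewrite /b; lra.
have := le_trans (PFP_ge mu (ltW c0) mU mV kernel) PFPle.
rewrite lee_fin sum_moment2_sqr -addrA gerDl leNgt ltr_wpDl//.
  by apply: sumr_ge0 => k _; exact: sqr_ge0.
exact: (mulr_gt0 (mulr_gt0 c0 muU) muV).
Qed.

(** Energy at most 1/d leaves no room for the square terms of
    [sum_moment2_sqr], so the second moments are those of I/d. *)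
Lemma Rintegral_sdot_sqr_isotropic (y : S) : (PFP mu p <= (d^-1)%:E)%E ->
  \int[mu]_x (sdot x y ^+ 2) = d^-1.
Proof.
move=> PFPle; have mE : forall k, moment2 mu k = d^-1 * (k.1 == k.2)%:R.
  by apply: moment2_isotropic; rewrite -lee_fin (le_trans sum_moment2_sqr_le_PFP).
rewrite Rintegral_sdot_sqr.
transitivity (d^-1 * sdot y y); last by rewrite sdotxx mulr1.
rewrite /sdot /dot mulr_sumr.
rewrite (eq_bigr (fun k => d^-1 * (k.1 == k.2)%:R * tensor2 (k.1, k.2) y)); last first.
  by case=> k l _; rewrite mE.
rewrite -(pair_bigA _ (fun k l => d^-1 * (k == l)%:R * tensor2 (k, l) y))/=.
apply: eq_bigr => i _; rewrite (bigD1 i)//= eqxx mulr1 big1 ?addr0// => j ji.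
by rewrite eq_sym (negbTE ji) mulr0 mul0r.
Qed.

End energy.

(** * Balanced measures on orthonormal frames *)

Section frame.
Context {R : realType} {n : nat}.
Local Notation S := (sphere R n).
Local Notation d := (n.+1%:R : R).
Context (x : 'I_n.+1 -> S)
  (orth : forall i j, sdot (x i) (x j) = (i == j)%:R).

(** The matrix X with rows x_i satisfies X X^T = 1; being square, it also
    satisfies X^T X = 1, which is the expansion of v. *)
Lemma orthonormal_expand (v : 'rV[R]_n.+1) :
  v = \sum_i dot v (sval_sphere (x i)) *: sval_sphere (x i).
Proof.
pose X := \matrix_(i, j) sval_sphere (x i) ord0 j.
have XXt : X *m X^T = 1%:M.
  by apply/matrixP => i j; rewrite !mxE -orth; apply: eq_bigr => k _; rewrite !mxE.
have := mulmx1C XXt => /(congr1 (mulmx v)); rewrite mulmx1 mulmxA => {1}<-.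
rewrite mulmx_sum_row; apply: eq_bigr => i _; congr (_ *: _).
  by rewrite !mxE; apply: eq_bigr => k _; rewrite !mxE.
by apply/rowP => j; rewrite !mxE.
Qed.

Lemma orthonormal_is_basis : orthonormal_basis x.
Proof.
split=> //; rewrite basisEdim size_image card_ord dimvf /dim/= mul1n leqnn andbT.
apply/subvP => v _; rewrite [v]orthonormal_expand; apply: memv_suml => i _.
by apply/memvZ/memv_span/codom_f.
Qed.

Lemma orthonormal_sdot_neq0 (y : S) : exists i, sdot (x i) y != 0.
Proof.
apply/existsP; apply: contraT => /existsPn y0.
have : sdot y y = 0.
  rewrite /sdot {1}[sval_sphere y]orthonormal_expand big1 => [|i _].
    by rewrite /dot big1// => i _; rewrite mxE mul0r.
  by have := y0 i; rewrite negbK /sdot dotC => /eqP ->; rewrite scale0r.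
by rewrite sdotxx => /eqP; rewrite oner_eq0.
Qed.

Lemma pm_setP (y : S) :
  pm_set x y <-> exists i, y = x i \/ y = antipode (x i).
Proof.
split=> [[[i _ <-]|[i _ <-]]|[i [->|->]]].
- by exists i; left.
- by exists i; right.
- by left; exists i.
- by right; exists i.
Qed.

Definition pair_set i : set S := [set x i] `|` [set antipode (x i)].

Lemma measurable_pair_set i : measurable (pair_set i).
Proof. by apply: measurableU; exact: measurable_sphere1. Qed.

(** On the frame |<y, x_i>| only takes the values 0 and 1, so that any
    positive power of it is the indicator of the pair {x_i, -x_i}. *)
Lemma normr_sdot_pm_set (y : S) i : pm_set x y ->
  `|sdot y (x i)| = \1_(pair_set i) y.
Proof.
rewrite indicE => /pm_setP[j yj].
have -> : `|sdot y (x i)| = (j == i)%:R.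
  by case: yj => ->; rewrite ?sdot_antipodel ?normrN orth ger0_norm.
congr (_%:R); congr nat_of_bool; apply/eqP/idP => [ji|].
  by rewrite inE; case: yj => ->; rewrite ji; [left|right].
move=> /set_mem; rewrite /pair_set/= => yi.
have : `|sdot y (x i)| = 1.
  by case: yi => ->; rewrite ?sdot_antipodel ?normrN sdotxx normr1.
case: yj => ->; rewrite ?sdot_antipodel ?normrN orth; case: eqP => //= _;
 by rewrite normr0 => /esym/eqP; rewrite oner_eq0.
Qed.

(** For y in the frame, the inner integral is the mass of the pair
    {y, -y}, which is 1/d whatever y is. *)
Lemma PFP_balanced (mu : probability S R) (p : R) : 0 < p ->
  mu (~` pm_set x) = 0 -> (forall i, mu (pair_set i) = (d^-1)%:E) ->
  PFP mu p = (d^-1)%:E.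
Proof.
move=> p0 null bal.
have ae_pm (f g : S -> \bar R) : (forall y, pm_set x y -> f y = g y) ->
    ae_eq mu setT f g.
  move=> fg; exists (~` pm_set x); split => //.
    exact: measurableC (measurable_pm_set x).
  by move=> y /= + /fg fgy; apply => _.
have inner y : pm_set x y ->
    (\int[mu]_z (`|sdot z y| `^ p)%:E)%E = (d^-1)%:E.
  move=> /pm_setP[i yi].
  transitivity (\int[mu]_z (\1_(pair_set i) z)%:E)%E; last first.
    rewrite integral_indic//; last exact: measurable_pair_set.
    by rewrite setIT; exact: bal.
  apply: ge0_ae_eq_integral => //.
  - apply/measurable_EFinP/(measurableT_comp (measurable_powR p)).
    by apply: measurableT_comp => //; exact: measurable_sdot.
  - by apply/measurable_EFinP/measurable_indic; exact: measurable_pair_set.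
  - suff kernelE (z : S) : pm_set x z -> (`|sdot z y| `^ p)%:E = (\1_(pair_set i) z)%:E.
      exact: (ae_pm _ _ kernelE).
    move=> zpm; congr EFin; have -> : `|sdot z y| = \1_(pair_set i) z.
      by rewrite -normr_sdot_pm_set//; case: yi => ->; rewrite ?sdot_antipoder ?normrN.
    by rewrite indicE; case: (_ \in _); rewrite ?powR1 ?powR0// gt_eqF.
rewrite /PFP (_ : (d^-1)%:E = \int[mu]_y (cst (d^-1)%:E y))%E; last first.
  by rewrite integral_cst// [X in (_ * X)%E]probability_setT mule1.
apply: ge0_ae_eq_integral => //.
- exact: measurable_PFP_inner.
- by move=> y _; apply: integral_ge0 => z _; rewrite lee_fin powR_ge0.
- by move=> y _; rewrite lee_fin invr_ge0.
- exact: ae_pm inner.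
Qed.

End frame.

Section competitor.
Context {R : realType} {n : nat}.
Local Notation S := (sphere R n).
Local Notation d := (n.+1%:R : R).

Lemma enorm_std_point (i : 'I_n.+1) : enorm (delta_mx ord0 i : 'rV[R]_n.+1) = 1.
Proof.
rewrite /enorm /dot (bigD1 i)//= big1 ?addr0 => [|j ji].
  by rewrite !mxE !eqxx mulr1 sqrtr1.
by rewrite !mxE (negbTE ji) andbF mul0r.
Qed.

Definition std_point (i : 'I_n.+1) : S := SigSub (mem_set (enorm_std_point i)).

Lemma sdot_std_point i j : sdot (std_point i) (std_point j) = (i == j)%:R.
Proof.
rewrite /sdot /dot (bigD1 i)//= big1 ?addr0 => [|k ki].
  by rewrite !mxE !eqxx mul1r.
by rewrite !mxE (negbTE ki) andbF mul0r.
Qed.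

(** The uniform measure on the standard basis, obtained by normalizing a sum of
    Dirac masses; P is the fallback that normalization requires for measures of
    mass zero or infinity. *)
Lemma exists_PFP_inv_dim (P : probability S R) (p : R) : 0 < p ->
  exists mu : probability S R, PFP mu p = (d^-1)%:E.
Proof.
move=> p0; pose m := msum (fun k =>
  dirac (std_point (inord k)) : {measure set S -> \bar R}) n.+1.
have mE A : m A = (\sum_(i < n.+1) \1_A (std_point i))%:E.
  by rewrite -sumEFin; apply: eq_bigr => i _; rewrite /dirac inord_val.
have mT : m setT = d%:E.
  rewrite mE; congr EFin; under eq_bigr do rewrite indicT.
  by rewrite sumr_const card_ord.
pose mu : probability S R := mnormalize m P.
have muE A : mu A = (\sum_(i < n.+1) \1_A (std_point i) / d)%:E.
  rewrite /mu /= /mnormalize [X in X == 0%E]mT eqe pnatr_eq0/=.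
  by rewrite [X in X == +oo%E]mT/= [X in fine X]mT/= [X in (X * _)%E]mE -EFinM mulr_suml.
exists mu; apply: (@PFP_balanced _ _ std_point sdot_std_point) => //.
  rewrite muE big1// => i _; rewrite indicE memNset ?mul0r//= => /(_ _).
  by apply; left; exists i.
move=> i; rewrite muE (bigD1 i)//= big1 ?addr0 => [|j ji].
  by rewrite indicE mem_set ?mul1r//; left.
rewrite indicE memNset ?mul0r// => -[]/(congr1 (sdot (std_point j))).
  by rewrite !sdot_std_point eqxx (negbTE ji) => /eqP; rewrite oner_eq0.
rewrite sdot_antipoder !sdot_std_point eqxx (negbTE ji) oppr0 => /eqP.
by rewrite oner_eq0.
Qed.

End competitor.

(** * An orthonormal basis inside the support *)

Section equality_case.
Context {R : realType} {n : nat} (mu : probability (sphere R n) R).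
Local Notation S := (sphere R n).
Local Notation d := (n.+1%:R : R).
Context (p : R) (p0 : 0 < p) (p2 : p < 2) (PFPle : (PFP mu p <= (d^-1)%:E)%E).

(** The function \sum_(i < k) <x_i, y>^2 has integral k/d < 1.  If no point of the
    support were orthogonal to all x_i, one of its terms would be 1 at every
    point of the support, which has full measure, and the integral would be at
    least 1. *)
Lemma supp_extend k (x : nat -> S) : (k < n.+1)%N ->
  (forall i, (i < k)%N -> supp mu (x i)) ->
  exists2 y, supp mu y & forall i, (i < k)%N -> sdot (x i) y = 0.
Proof.
move=> kn sx; apply: contrapT => noy.
have intx : mu.-integrable setT
    (EFin \o (fun y => \sum_(i < k) 1 * (sdot y (x i)) ^+ 2)).
  by apply: integrable_lin => i; exact: integrable_sdot_sqr.
have msupp : measurable (supp mu).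
  rewrite -[supp mu]setCK.
  exact: measurableC (open_sphere_measurable (open_setC_supp mu)).
have : \int[mu]_y (1 * \1_(supp mu) y) <=
       \int[mu]_y (\sum_(i < k) 1 * (sdot y (x i)) ^+ 2).
  apply: le_Rintegral => //; first exact: integrable_indicr.
  move=> y _; rewrite indicE mul1r.
  have ge0 (P : pred 'I_k) : 0 <= \sum_(i < k | P i) 1 * sdot y (x i) ^+ 2.
    by apply: sumr_ge0 => i _; rewrite mul1r sqr_ge0.
  have [/set_mem sy|_] := boolP (y \in supp mu); last exact: ge0.
  have [i xiy] : exists i : 'I_k, sdot (x i) y != 0.
    apply: contrapT => /forallNP xy0; apply: noy; exists y => // i ik.
    by apply/eqP; apply: contraT => h; case: (xy0 (Ordinal ik)).
  rewrite (bigD1 i)//= mul1r -real_normK ?num_real// sdotC.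
  have [xy|->] := supp_sdot01 p0 p2 PFPle (sx i (ltn_ord i)) sy.
    by rewrite xy eqxx in xiy.
  by rewrite expr1n lerDl.
rewrite Rintegral_indicr// Rintegral_lin; last by move=> i; exact: integrable_sdot_sqr.
under eq_bigr do rewrite mul1r (Rintegral_sdot_sqr_isotropic p2)//.
have -> : fine (mu (supp mu)) = 1.
  have := probability_setC mu (open_sphere_measurable (open_setC_supp mu)).
  by rewrite setCK measure_setC_supp sube0 => ->.
rewrite sumr_const card_ord mul1r -[_ *+ k]mulr_natl ler_pdivlMr ?ltr0n// mul1r ler_nat.
by rewrite leqNgt kn.
Qed.

(** The families are indexed by nat, with only the first k values relevant, to
    extend them without changing the index type. *)
Lemma supp_orthonormal k : (k <= n.+1)%N -> exists x : nat -> S,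
  (forall i, (i < k)%N -> supp mu (x i)) /\
  (forall i j, (i < k)%N -> (j < k)%N -> sdot (x i) (x j) = (i == j)%:R).
Proof.
elim: k => [_|k IH kn]; first by exists (fun=> point); split.
have [x [sx ox]] := IH (ltnW kn).
have [y sy xy] := supp_extend kn sx.
exists (fun i => if (i == k)%N then y else x i); split=> [i|i j]; rewrite !ltnS.
  by case: ltngtP => // ik _; exact: sx.
case: (ltngtP i k) => // ik _; case: (ltngtP j k) => // jk _.
- exact: ox.
- by rewrite xy// jk (ltn_eqF ik).
- by rewrite sdotC xy// ik eq_sym (ltn_eqF jk).
- by rewrite sdotxx ik jk eqxx.
Qed.

Lemma supp_orthonormal_basis : exists x : 'I_n.+1 -> S,
  [/\ orthonormal_basis x, range x `<=` supp mu & supp mu `<=` pm_set x].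
Proof.
have [x [sx ox]] := supp_orthonormal (leqnn n.+1).
pose z (i : 'I_n.+1) := x i.
have oz i j : sdot (z i) (z j) = (i == j)%:R by rewrite /z ox.
exists z; split.
- exact: orthonormal_is_basis.
- by move=> _ [i _ <-]; exact: sx.
- move=> y sy; have [i ziy] := orthonormal_sdot_neq0 oz y.
  have [e|/normr_sdot_eq1] := supp_sdot01 p0 p2 PFPle (sx i (ltn_ord i)) sy.
    by move: ziy; rewrite /z e eqxx.
  by move=> h; apply/pm_setP; exists i.
Qed.

End equality_case.

(** * Measures carried by a frame and their densities *)

Section atoms.
Context {R : realType} {n : nat}.
Local Notation S := (sphere R n).
Context (x : 'I_n.+1 -> S)
  (orth : forall i j, sdot (x i) (x j) = (i == j)%:R).

(** An injective enumeration of the frame, which turns sums over the set of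
    points into sums over a finite type. *)
Definition signed_point (k : 'I_n.+1 * bool) : S :=
  if k.2 then antipode (x k.1) else x k.1.

Lemma signed_point_inj : injective signed_point.
Proof.
have pos1 (b : bool) : 1 = b%:R :> R -> b.
  by case: b => // /eqP; rewrite oner_eq0.
have neg1 (b : bool) : 1 <> - b%:R :> R by case: b => /=; lra.
move=> [i b] [j c]; rewrite /signed_point /=.
case: b; case: c => /(congr1 (sdot (x i))); rewrite ?sdot_antipoder sdotxx orth.
- by move=> /oppr_inj/pos1/eqP ->.
- by move=> /(congr1 -%R); rewrite opprK => /neg1.
- by move=> /neg1.
- by move=> /pos1/eqP ->.
Qed.

Lemma pm_set_signed_point (y : S) : pm_set x y <-> exists k, y = signed_point k.
Proof.
rewrite pm_setP; split=> [[i [->|->]]|[[i b] ->]].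
- by exists (i, false).
- by exists (i, true).
- by exists i; rewrite /signed_point /=; case: b; [right|left].
Qed.

Lemma sum_signed_point (F : 'I_n.+1 * bool -> R) (k : 'I_n.+1 * bool) :
  \sum_l F l * \1_[set signed_point l] (signed_point k) = F k.
Proof.
rewrite (bigD1 k)//= big1 ?addr0 => [|l lk].
  by rewrite indicE mem_set// mulr1.
rewrite indicE memNset ?mulr0//= => /signed_point_inj kl.
by rewrite kl eqxx in lk.
Qed.

Lemma nu_pm_signed_point (A : set S) k :
  nu_pm x ([set signed_point k] `&` A) = (\1_A (signed_point k))%:E.
Proof.
rewrite /nu_pm/= /mrestr/= indicE.
have spk : pm_set x (signed_point k) by apply/pm_set_signed_point; exists k.
have [/set_mem Ak|/negP nAk] := boolP (_ \in A).
  rewrite (_ : _ `&` _ = [set signed_point k]).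
    by rewrite /counting asboolT// fset_set1 finmap.cardfs1.
  by apply/seteqP; split => [y [[]]//|_ ->].
rewrite (_ : _ `&` _ = set0); first exact: measure0.
by apply/seteqP; split => // y [[/= -> /mem_set]].
Qed.

(** Both measures of A are the sum of the atoms of mu that lie in A: mu because
    it is carried by the frame, the integral because the counting measure gives
    mass 1 to each of its points. *)
Lemma atomic_density (mu : probability S R) : mu (~` pm_set x) = 0 ->
  has_density mu (nu_pm x)
    (fun y => \sum_k fine (mu [set signed_point k]) * \1_[set signed_point k] y).
Proof.
move=> null; split.
  apply: measurable_sum => k; apply: measurable_funM => //.
  by apply: measurable_indic; exact: measurable_sphere1.
move=> A mA.
have m1 k : measurable [set signed_point k] by exact: measurable_sphere1.
have fmu k : mu [set signed_point k] \is a fin_num by exact: fin_num_measure.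
transitivity (\sum_k (fine (mu [set signed_point k]) * \1_A (signed_point k))%:E)%E.
  transitivity (\int[mu]_y
    (\sum_k \1_A (signed_point k) * \1_[set signed_point k] y)%:E)%E.
    rewrite -[A in LHS]setIT -integral_indic//.
    apply: ge0_ae_eq_integral => //.
    - by apply/measurable_EFinP; exact: measurable_indic.
    - apply/measurable_EFinP/measurable_sum => k; exact: measurable_funM.
    - move=> y _; rewrite lee_fin; apply: sumr_ge0 => k _.
      by rewrite mulr_ge0// indicE ler0n.
    - exists (~` pm_set x); split => //.
        exact: measurableC (measurable_pm_set x).
      move=> y /= + /pm_set_signed_point[k yk]; apply => _.
      by rewrite yk (@sum_signed_point (fun k => \1_A (signed_point k))).
  have int1 k : mu.-integrable setT (EFin \o \1_[set signed_point k]).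
    have := @integrable_indicr _ _ _ mu [set signed_point k] 1 (m1 k).
    by under [X in _ \o X]eq_fun do rewrite mul1r.
  rewrite EFin_Rintegral; last exact: integrable_lin.
  rewrite Rintegral_lin// sumEFin; congr EFin; apply: eq_bigr => k _.
  by rewrite mulrC /Rintegral integral_indic// setIT.
under [RHS]eq_integral do rewrite -sumEFin.
rewrite ge0_integral_sum//.
- apply: eq_bigr => k _.
  rewrite (@integralZl_indic _ _ _ _ A mA (fun=> [set signed_point k]))//.
    by rewrite integral_indic// nu_pm_signed_point EFinM.
  by rewrite ltNge fine_ge0.
- move=> k; apply/measurable_EFinP; exact: measurable_funM.
- by move=> k y _; rewrite lee_fin mulr_ge0 ?fine_ge0// indicE ler0n.
Qed.

Lemma density_atom (mu : probability S R) (f : S -> R) k :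
  has_density mu (nu_pm x) f ->
  mu [set signed_point k] = (f (signed_point k))%:E.
Proof.
move=> [mf ->]; last exact: measurable_sphere1.
rewrite (eq_integral (cst (f (signed_point k))%:E)).
  rewrite integral_cst; last exact: measurable_sphere1.
  by have := nu_pm_signed_point setT k; rewrite setIT indicT => ->; rewrite mule1.
by move=> y /set_mem ->.
Qed.

Lemma density_null (mu : probability S R) (f : S -> R) :
  has_density mu (nu_pm x) f -> mu (~` pm_set x) = 0.
Proof.
move=> [mf ->]; last exact: measurableC (measurable_pm_set x).
apply: null_set_integral.
- exact: measurableC (measurable_pm_set x).
- by apply/measurable_EFinP; exact: measurable_funTS.
- by rewrite /nu_pm/= /mrestr/= setICl measure0.
Qed.

Lemma measure_pair_set (mu : probability S R) i :
  mu (pair_set x i) = (mu [set x i] + mu [set antipode (x i)])%E.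
Proof.
rewrite /pair_set measureU//; try exact: measurable_sphere1.
by apply/seteqP; split => // y [-> /antipode_neq].
Qed.

(** On the frame, <y, x_i>^2 is the indicator of {x_i, -x_i}: this converts the
    isotropy of mu into the value of the masses. *)
Lemma pair_set_mass (mu : probability S R) i : mu (~` pm_set x) = 0 ->
  fine (mu (pair_set x i)) = \int[mu]_y (sdot y (x i) ^+ 2).
Proof.
move=> null; have mP := measurable_pair_set x i.
rewrite -[fine _]mul1r -Rintegral_indicr//; congr fine.
apply: ge0_ae_eq_integral => //.
- by apply/measurable_EFinP/measurable_funM => //; exact: measurable_indic.
- by apply/measurable_EFinP/measurable_funX; exact: measurable_sdot.
- by move=> y _; rewrite lee_fin sqr_ge0.
- exists (~` pm_set x); split => //.
    exact: measurableC (measurable_pm_set x).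
  move=> y /= + ypm; apply => _; congr EFin.
  rewrite -real_normK ?num_real// (normr_sdot_pm_set orth i ypm) indicE.
  by case: (_ \in _); rewrite mul1r ?expr1n ?expr0n.
Qed.

End atoms.

(** * Characterization of the minimizers *)

Theorem theorem4p9 (R : realType) (n : nat) (p : R) (hp0 : 0 < p) (hp2 : p < 2)
    (mu : probability (sphere R n) R) :
  PFP_minimizer p mu <->
  exists x : 'I_n.+1 -> sphere R n,
    [/\ orthonormal_basis x,
        range x `<=` supp mu /\ supp mu `<=` pm_set x &
        exists f : sphere R n -> R,
          has_density mu (nu_pm x) f /\
          (forall i : 'I_n.+1, f (x i) + f (antipode (x i)) = n.+1%:R^-1)].
Proof.
split=> [minmu|[x [[_ orth] _ [f [df fd]]]] nu]; last first.
  apply: le_trans (PFP_lower_bound nu hp2).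
  rewrite (PFP_balanced orth hp0 (density_null df))// => i.
  rewrite measure_pair_set -(fd i) EFinD; congr (_ + _)%E.
    exact: (density_atom (i, false) df).
  exact: (density_atom (i, true) df).
have [nu nuE] := exists_PFP_inv_dim mu hp0.
have PFPle : (PFP mu p <= (n.+1%:R^-1)%:E)%E by rewrite -nuE; exact: minmu.
have [x [bx xs sx]] := supp_orthonormal_basis hp0 hp2 PFPle.
have orth := bx.2.
have null : mu (~` pm_set x) = 0.
  apply: (subset_measure0 _ _ _ (measure_setC_supp mu)).
  - exact: measurableC (measurable_pm_set x).
  - exact: open_sphere_measurable (open_setC_supp mu).
  - exact: subsetC.
exists x; split => //.
exists (fun y =>
  \sum_k fine (mu [set signed_point x k]) * \1_[set signed_point x k] y).
split; first exact: atomic_density.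
move=> i; have atomE :=
  sum_signed_point orth (fun k => fine (mu [set signed_point x k])).
rewrite (atomE (i, false)) (atomE (i, true)) -fineD;
  [|exact: fin_num_measure (measurable_sphere1 _)..].
rewrite -measure_pair_set pair_set_mass//.
exact: Rintegral_sdot_sqr_isotropic PFPle.
Qed.
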